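(* For every integer $n\ge 0$ let $T_n=[x^n](1+x+x^2)^n=\sum_{l=0}^{\lfloor n/2\rfloor}\binom{n}{2l}\binom{2l}{l}$ be the $n$-th central trinomial coefficient. Then for every prime $p>3$, \[ \sum_{k=0}^{p-1}k(k+1)(8k+9)T_kT_{k+1}\equiv -p^2\left(\frac{53}{12}+\frac{21}{4}\left(\frac{p}{3}\right)\right)\pmod{p^3}. \]
   Context: $\left(\frac{p}{3}\right)$ is the Legendre symbol. A congruence between rational numbers whose denominators are coprime to $p$ means that their difference, as an element of the localization $\mathbb{Z}_{(p)}$, lies in $p^3\mathbb{Z}_{(p)}$. *)

(* Defs.v *)
From mathcomp Require Import all_boot all_order all_algebra.

Set Implicit Arguments.
Unset Strict Implicit.
Unset Printing Implicit Defensive.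

Import GRing.Theory.
Local Open Scope ring_scope.

Definition central_trinomial (n : nat) : int :=
  ((1 + 'X + 'X^2 : {poly int}) ^+ n)`_n.

Lemma central_trinomialE (n : nat) :
  central_trinomial n =
    (\sum_(0 <= l < n./2.+1) 'C(n, l.*2) * 'C(l.*2, l))%N%:Z.
Proof.
rewrite /central_trinomial.
have -> : 1 + 'X + 'X^2 = 'X + ('X^2 + 1) :> {poly int}
  by rewrite -addrA addrC -addrA.
rewrite exprDn coef_sum big_mkord.
transitivity (\sum_(i < n.+1) \sum_(j < n.+1)
   (i == j.*2 :> nat)%:R *+ ('C(n, i) * 'C(i, j)) : int).
  apply: eq_bigr => i _; rewrite coefMn coefXnM.
  have lein : (i <= n)%N by rewrite -ltnS.
  rewrite ltnNge leq_subr /= subKn // exprD1n coef_sum.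
  rewrite (big_ord_widen n.+1
    (fun j => ('X^2 ^+ j *+ 'C(i, j) : {poly int})`_i)) //.
  rewrite -sumrMnl big_mkcond /=; apply: eq_bigr => j _.
  case: ltnP => [_|ltij]; last by rewrite (bin_small ltij) muln0 mulr0n.
  by rewrite coefMn -exprM mul2n coefXn -mulrnA mulnC.
rewrite exchange_big /= (big_ord_widen n.+1
  (fun l => 'C(n, l.*2) * 'C(l.*2, l))%N); last by rewrite ltnS -divn2 leq_div.
rewrite -natz natr_sum [RHS]big_mkcond /=; apply: eq_bigr => j _.
rewrite ltnS geq_half_double.
case: leqP => [le2n|lt2n].
  have lt2 : (j.*2 < n.+1)%N by [].
  rewrite (bigD1 (Ordinal lt2)) //= eqxx big1 ?addr0 // => i neq.
  by rewrite -val_eqE /= in neq; rewrite (negbTE neq) mul0rn.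
rewrite big1 // => i _; case: eqP => [e|_]; last by rewrite mul0rn.
by move: (ltn_ord i); rewrite e ltnS leqNgt lt2n.
Qed.

(* The Legendre symbol (a / q), for q an odd prime. *)
Definition legendre (a : int) (q : nat) : int :=
  if (q%:Z %| a)%Z then 0
  else if [exists x : 'I_q, (x%:Z ^+ 2 == a %[mod q])%Z] then 1 else -1.

(* Membership of a rational number in the localization Z_(p), p prime. *)
Definition in_localization (p : nat) (x : rat) : bool :=
  coprime `|denq x|%N p.

(* Congruence modulo p ^ m Z_(p). *)
Definition congr_localization (p m : nat) (x y : rat) : Prop :=
  exists2 z : rat, in_localization p z & x - y = p%:R ^+ m * z.

(* Main.v *)
(* With [P = 1 + x + x^2], the central trinomial coefficients satisfy
   (n+2) T_(n+2) = (2n+3) T_(n+1) + 3(n+1) T_n, and this makes the sum telescope: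
   24 times the sum over k < n is n^2 times a quadratic form in T_n, T_(n-1)
   whose coefficients are integer polynomials in n. For n = p it remains to know
   T_p and T_(p-1) modulo p, and by Frobenius P^p = 1 + x^p + x^(2p) these are
   1 and (p/3). *)
Require Import Defs.
From mathcomp Require Import all_boot all_order all_algebra.
From mathcomp Require Import zify ring.

Set Implicit Arguments.
Unset Strict Implicit.
Unset Printing Implicit Defensive.

Import GRing.Theory Num.Theory.
Local Open Scope ring_scope.

(* The recurrence is read off the coefficients of [x^(n+1)] in [(P^(n+2))'] and of
   [x^n] in [(P^(n+1) P')'], with [P = 1 + x + x^2], using [P'^2 = 4 P - 3]. *)
Lemma central_trinomialSS (n : nat) :
  n.+2%:R * central_trinomial n.+2
  = (2 * n + 3)%:R * central_trinomial n.+1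
    + (3 * n.+1)%:R * central_trinomial n.
Proof.
rewrite /central_trinomial; set P : {poly int} := _ + 'X^2.
have coef_natM k (q : {poly int}) i : (k%:R * q)`_i = k%:R * q`_i.
  by rewrite !mulr_natl coefMn.
have coef_derivM (q : {poly int}) i : q^`()`_i = i.+1%:R * q`_i.+1.
  by rewrite coef_deriv mulr_natl.
have dP : P^`() = 1 + 2%:R * 'X by rewrite !derivE /= expr1 add0r mulr_natl.
have dPX k : (P ^+ k.+1)^`() = k.+1%:R * (P ^+ k * P^`()).
  by rewrite deriv_exp /= mulr_natl mulrC.
have T_SS : (P ^+ n.+2)`_n.+2 = (P ^+ n.+1 * P^`())`_n.+1.
  have := coef_derivM (P ^+ n.+2) n.+1; rewrite dPX coef_natM.
  by move/mulfI => -> //; rewrite pnatr_eq0.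
have T_step : (P ^+ n.+2)`_n.+2 = (P ^+ n.+1)`_n.+1 + 2%:R * (P ^+ n.+1)`_n.
  by rewrite T_SS dP mulrDr mulr1 coefD mulrCA coef_natM coefMX.
have dQ : (P ^+ n.+1 * P^`())^`()
    = (4 * n + 6)%:R * P ^+ n.+1 - (3 * n.+1)%:R * P ^+ n.
  rewrite derivM dPX dP.
  have -> : (1 + 2%:R * 'X)^`() = 2%:R :> {poly int}.
    by rewrite mulr_natl !derivE add0r.
  rewrite [P ^+ n.+1]exprS.
  have : (1 + 2%:R * 'X) ^+ 2 = 4%:R * P - 3%:R by rewrite /P; ring.
  rewrite -(addn1 n) !(natrD, natrM); move: (1 + _ * 'X) (P ^+ n) => D Q D2.
  by ring: D2.
have := congr1 (fun q : {poly int} => q`_n) dQ.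
rewrite /= coef_derivM -T_SS coefB !coef_natM.
move: T_step; rewrite -(addn2 n) -(addn1 n) !(natrD, natrM).
(* Both relations involve the off-centre coefficient [a]; eliminating it leaves the recurrence. *)
set t0 := (P ^+ n)`_n; set a := (P ^+ (n + 1))`_n => T_step dQn.
have -> : 3%:R * (n%:R + 1) * t0 = (4%:R * n%:R + 6%:R) * a
    - (n%:R + 1) * (P ^+ (n + 2))`_(n + 2).
  by rewrite dQn; ring.
by rewrite T_step; ring.
Qed.

(** Here [u] and [t] stand for T_n and T_(n-1). The ring is arbitrary so that the form can be
    carried from integers to rationals and to 'F_p. *)
Definition telescoped_form (R : comNzRingType) (n u t : R) : R :=
  (- 25 + 20 * n + - 4 * n ^+ 2) * u ^+ 2
  + (- 126 + 120 * n + 24 * n ^+ 2) * u * t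
  + (- 81 + 108 * n + - 36 * n ^+ 2) * t ^+ 2.

Lemma rmorph_telescoped_form (R S : comNzRingType) (f : {rmorphism R -> S})
    (n u t : R) :
  f (telescoped_form n u t) = telescoped_form (f n) (f u) (f t).
Proof.
rewrite /telescoped_form.
(* Stated for arbitrary coefficients, since [rmorphD] unifies with literals. *)
have f_quad a b c : f (a + b * n + c * n ^+ 2) = f a + f b * f n + f c * f n ^+ 2.
  by rewrite 2!rmorphD !rmorphM.
have f_form a b c : f (a * u ^+ 2 + b * u * t + c * t ^+ 2)
    = f a * f u ^+ 2 + f b * f u * f t + f c * f t ^+ 2.
  by rewrite 2!rmorphD !rmorphM.
by rewrite f_form !f_quad !rmorphN !rmorph_nat.
Qed.

Lemma sum_central_trinomial (n : nat) :
  let T k : rat := (central_trinomial k)%:~R in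
  24 * (\sum_(0 <= k < n.+1)
          k%:R * (k%:R + 1) * (8 * k%:R + 9) * T k * T (k + 1)%N)
  = n.+1%:R ^+ 2 * telescoped_form n.+1%:R (T n.+1) (T n).
Proof.
move=> T; rewrite /telescoped_form.
have T0 : T 0%N = 1 by rewrite /T central_trinomialE big_nat1.
have T1 : T 1%N = 1 by rewrite /T central_trinomialE big_nat1.
elim: n => [|n IHn].
  by rewrite big_nat1 T0 T1.
rewrite big_nat_recr //= mulrDr IHn.
(* With [T n.+2] eliminated, the induction step is a rational identity in n, [T n.+1] and [T n]. *)
have rec : T n.+2 = ((2 * n%:R + 3) * T n.+1 + 3 * (n%:R + 1) * T n) / (n%:R + 2).
  have := congr1 (fun z : int => z%:~R : rat) (central_trinomialSS n).
  rewrite rmorphD /= !rmorphM /= !rmorph_nat -/(T _) -/(T _) -/(T _) => e.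
  have n2 : n%:R + 2 != 0 :> rat by rewrite -natrD pnatr_eq0 addn2.
  apply: (canRL (mulfK n2)); move: e.
  rewrite -(addn2 n) -(addn1 n) !(natrD, natrM) => e.
  by rewrite mulrC.
rewrite addn1 rec -(addn2 n) -(addn1 n) !natrD; field.
by rewrite -natrD pnatr_eq0 addn2.
Qed.

Lemma intr_central_trinomial (R : comNzRingType) (n : nat) :
  (central_trinomial n)%:~R = ((1 + 'X + 'X^2 : {poly R}) ^+ n)`_n.
Proof.
rewrite /central_trinomial -(coef_map (intmul 1 : {rmorphism int -> R})).
by rewrite rmorphXn /= !rmorphD /= rmorph1 map_polyX map_polyXn.
Qed.

Lemma trinomial_Frobenius (R : comNzRingType) (p : nat) (charRp : p \in [pchar R]) :
  (1 + 'X + 'X^2 : {poly R}) ^+ p = 1 + 'X^p + 'X^(2 * p).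
Proof.
have charXp : p \in [pchar {poly R}] by rewrite pchar_poly.
have charp : [pchar {poly R}].-nat p by rewrite pnatE ?(pcharf_prime charRp).
by rewrite !exprDn_pchar // expr1n -exprM.
Qed.

Lemma central_trinomial_pchar (R : comNzRingType) (p : nat) (charRp : p \in [pchar R]) :
  (central_trinomial p)%:~R = 1 :> R.
Proof.
rewrite intr_central_trinomial (trinomial_Frobenius charRp) !coefD coef1 !coefXn eqxx.
have p_gt0 := prime_gt0 (pcharf_prime charRp).
by rewrite (gtn_eqF p_gt0) ltn_eqF ?add0r ?addr0 // mul2n -addnn -addn1 leq_add2l.
Qed.

(* [P^(p-1) (1 - x^3) = (1 - x) P^p], so below degree [p] the coefficients of
   [P^(p-1)] are those of the power series [(1 - x) / (1 - x^3)]. *)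
Lemma coef_trinomial_predp (R : comNzRingType) (p : nat) (charRp : p \in [pchar R])
    (n : nat) :
  (n < p)%N ->
  ((1 + 'X + 'X^2 : {poly R}) ^+ p.-1)`_n = (n %% 3 == 0)%N%:R - (n %% 3 == 1)%N%:R.
Proof.
set C := _ ^+ p.-1.
have p_gt0 := prime_gt0 (pcharf_prime charRp).
have eC : C = C * 'X^3 + (1 - 'X) * (1 + 'X^p + 'X^(2 * p)).
  rewrite -(trinomial_Frobenius charRp) -{1}(prednK p_gt0) [_ ^+ p.-1.+1]exprS -/C; ring.
(* Below degree p, [eC] makes the coefficients repeat with period 3, starting from 1, -1, 0. *)
elim/ltn_ind: n => n IHn lt_np.
have lt_n2p : (n < 2 * p)%N by lia.
rewrite eC coefD coefMXn mulrDr mulrDr mulr1 !coefD !coefMXn lt_np lt_n2p !addr0.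
rewrite coefN coef1 coefX.
case: ltnP => [|le3n]; first by case: n {IHn lt_np lt_n2p} => [|[|[|]]] //=; rewrite add0r.
rewrite IHn; [|lia..].
have -> : ((n - 3) %% 3 = n %% 3)%N by rewrite -{2}(subnK le3n) modnDr.
by case: n le3n {IHn lt_np lt_n2p} => [|[|n]] //= _; rewrite subr0 addr0.
Qed.

Lemma legendre3 (p : nat) :
  legendre p%:Z 3 = (p %% 3 == 1)%N%:R - (p %% 3 == 2)%N%:R.
Proof.
rewrite /legendre dvdzE /= /dvdn.
have -> : [exists x : 'I_3, (x%:Z ^+ 2 == p %[mod 3])%Z]
   = [exists x : 'I_3, (x ^ 2 %% 3 == p %% 3)%N].
  by apply: eq_existsb => x; rewrite expr2 -PoszM mulnn !modz_nat.
have : (p %% 3 < 3)%N by rewrite ltn_mod.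
case: (p %% 3)%N => [|[|[|]]] //= _.
  case: existsP => // -[]; by exists (@Ordinal 3 1 isT).
by case: existsP => // -[[[|[|[|]]] ]].
Qed.

(** The reduced denominator divides d: it divides numerator times d and is coprime to the
    numerator. *)
Lemma in_localization_div (p d : nat) (m : int) :
  (0 < d)%N -> coprime d p -> in_localization p (m%:~R / d%:R).
Proof.
move=> d_gt0; set x := _ / _; apply: coprime_dvdl.
have d0 : d%:R != 0 :> rat by rewrite pnatr_eq0 -lt0n.
have : numq x * d%:Z = m * denq x.
  apply: (@intr_inj rat); rewrite !rmorphM /= numqE /x.
  by rewrite -/x mulrAC; congr (_ * _); rewrite /x divfK.
move/(congr1 absz); rewrite !abszM => e.
rewrite -(@Gauss_dvdr _ `|numq x|) ?e ?dvdn_mull //.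
by rewrite coprime_sym coprime_num_den.
Qed.

Theorem theorem1p2 (p : nat) (p_prime : prime p) (p_gt3 : (3 < p)%N) :
  congr_localization p 3
    (\sum_(0 <= k < p) k%:R * (k%:R + 1) * (8 * k%:R + 9)
       * (central_trinomial k)%:~R * (central_trinomial (k + 1))%:~R)
    (- (p%:R ^+ 2) * (53 / 12 + 21 / 4 * (legendre p%:Z 3)%:~R)).
Proof.
set l := legendre p 3; set S := \sum_(_ <= k < _) _.
have charFp := pchar_Fp p_prime.
have p_gt0 := prime_gt0 p_prime.
set t := central_trinomial p.-1; set u := central_trinomial p.
set E : int := telescoped_form p%:R u t.
have sumE : 24 * S = p%:R ^+ 2 * E%:~R.
  have := sum_central_trinomial p.-1; rewrite /= prednK // => ->.
  by rewrite /E rmorph_telescoped_form rmorph_nat.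
have p3 : (p %% 3 = 1 \/ p %% 3 = 2)%N.
  have : ~~ (3 %| p)%N by rewrite dvdn_prime2 // ltn_eqF.
  rewrite /dvdn; have : (p %% 3 < 3)%N by rewrite ltn_mod.
  by case: (p %% 3)%N => [|[|[|]]]; auto.
have uF : u%:~R = 1 :> 'F_p by rewrite (central_trinomial_pchar charFp).
have tF : t%:~R = l%:~R :> 'F_p.
  rewrite intr_central_trinomial (coef_trinomial_predp charFp) ?prednK //.
  (* As 3 does not divide p, p - 1 is 0 or 1 modulo 3, giving the coefficient 1 or -1, which is
     (p/3). *)
  have -> : (p.-1 %% 3 = (p %% 3).-1)%N by lia.
  by rewrite /l legendre3; case: p3 => ->; rewrite rmorphB.
have l2 : l ^+ 2 = 1 by rewrite /l legendre3; case: p3 => ->.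
have lF : l%:~R ^+ 2 = 1 :> 'F_p by rewrite -rmorphXn l2.
have EF : E%:~R = telescoped_form 0 1 l%:~R :> 'F_p.
  by rewrite /E rmorph_telescoped_form rmorph_nat (pcharf0 charFp) /= uF tF.
(* At n = 0, u = 1, t = l the form is -25 - 126 l - 81 l^2, and l^2 = 1. Moreover 106 = 24 * 53/12
   and 126 = 24 * 21/4. *)
have : (p%:Z %| E + 106 + 126 * l)%Z.
  rewrite (dvdz_pcharf charFp) 2!rmorphD rmorphM 2!rmorph_nat /= EF.
  by rewrite /telescoped_form; apply/eqP; ring: lF.
case/dvdzP => m Em.
(* Since S = p^2 E / 24 and E = m p - 106 - 126 l, the difference of the two sides is p^3 m / 24. *)
exists (m%:~R / 24).
  apply: in_localization_div => //.
  rewrite (_ : 24 = 2 ^ 3 * 3)%N // coprimeMl coprime_pexpl //.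
  by rewrite !prime_coprime // !dvdn_prime2 // !ltn_eqF // ltnW.
have -> : S = p%:R ^+ 2 * E%:~R / 24 by rewrite -sumE; field.
have -> : E = m * p%:Z - 106 - 126 * l by rewrite -Em; ring.
rewrite !rmorphB !rmorphM !rmorph_nat /=.
by field.
Qed.
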